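(* Let $n\geq 2$ be a fixed integer. Then \[ \liminf_{q\rightarrow\infty}\frac{C(n,q)}{q^n/n}\geq \left(\frac{n-1}{n}\right)^{n-1}. \]
   Context: Let $F$ be a finite alphabet with $|F|=q$. Two words $u,v\in F^n$ (not necessarily distinct) are overlapping if a non-empty proper prefix of $u$ equals a non-empty proper suffix of $v$, or a non-empty proper prefix of $v$ equals a non-empty proper suffix of $u$. A code $C\subseteq F^n$ is non-overlapping if for all (not necessarily distinct) $u,v\in C$, the words $u$ and $v$ are not overlapping. $C(n,q)$ denotes the maximum cardinality of a non-overlapping code $C\subseteq F^n$ with $|F|=q$. *)

(* Defs.v *)
From mathcomp Require Import all_boot all_order all_algebra.
From mathcomp Require Import all_classical all_reals all_analysis.

Set Implicit Arguments.
Unset Strict Implicit.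
Unset Printing Implicit Defensive.

Import Order.TTheory GRing.Theory Num.Theory.

Local Open Scope nat_scope.

Definition proper_prefix (F : eqType) (w u : seq F) : bool :=
  prefix w u && (w != u).

Definition proper_suffix (F : eqType) (w u : seq F) : bool :=
  suffix w u && (w != u).

Definition prefix_meets_suffix (F : eqType) (u v : seq F) : Prop :=
  exists w : seq F, [/\ w != [::], proper_prefix w u & proper_suffix w v].

Definition overlapping (F : eqType) (u v : seq F) : Prop :=
  prefix_meets_suffix u v \/ prefix_meets_suffix v u.

(* The case u = v is included: a word of C must not overlap itself. *)
Definition non_overlapping (F : finType) (n : nat) (C : {set n.-tuple F}) :
    Prop :=
  forall u v : n.-tuple F, u \in C -> v \in C -> ~ overlapping u v.

(* C(n, q), with 'I_q as the alphabet of size q; the empty code is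
   non-overlapping, so the maximum is over a non-empty family. *)
Definition max_non_overlapping (n q : nat) : nat :=
  \max_(C : {set n.-tuple 'I_q} | `[< non_overlapping C >]) #|C|.

(* Main.v *)
(* Split an alphabet of size [l + m] into [l] "tail" letters and [m] "head"
   letters. The words made of one head letter followed by [n - 1] tail letters
   form a non-overlapping code: a non-empty prefix contains a head letter, a
   proper suffix does not. Its size is [m * l ^ (n - 1)], and
   [l = floor ((n - 1) q / n)] gives the asymptotically optimal choice. *)

Require Import Defs.
From mathcomp Require Import all_boot all_order all_algebra.
From mathcomp Require Import all_classical all_reals all_analysis.

Import Order.TTheory GRing.Theory Num.Theory.
Import numFieldNormedType.Exports.
Local Open Scope ring_scope.

(** Heads are the image of [rshift], tails that of [lshift]. From here on [n] counts only the tail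
    letters, so words have length [n.+1]. *)
Definition head_tail_word {l m n : nat} (p : 'I_m * n.-tuple 'I_l) :
    n.+1.-tuple 'I_(l + m) :=
  [tuple of rshift l p.1 :: map_tuple (lshift m) p.2].

Lemma head_tail_word_inj (l m n : nat) : injective (@head_tail_word l m n).
Proof.
move=> [i s] [j t] /(congr1 val)/eqP /=.
rewrite eqseq_cons => /andP[/eqP/rshift_inj -> /eqP/inj_map st].
by congr pair; apply/val_inj/st; exact: lshift_inj.
Qed.

Lemma head_tail_words_prefix_meets_suffix (l m n : nat)
    (p r : 'I_m * n.-tuple 'I_l) :
  ~ prefix_meets_suffix (head_tail_word p) (head_tail_word r).
Proof.
case=> -[[//]|x w] [_ /andP[]].
rewrite prefix_cons => /andP[/eqP -> _] _ /andP[/suffixP[[|y z]]].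
  (* With nothing cut off, the suffix is the whole word, hence not proper. *)
  by move=> /= ->; rewrite eqxx.
(* Otherwise the suffix lies inside the tail, so the head letter of [p] would be a tail letter. *)
move=> [_ E] _; have : rshift l p.1 \in map (lshift m) r.2.
  by rewrite E mem_cat mem_head orbT.
by case/mapP => k _ /eqP; rewrite eq_rlshift.
Qed.

Lemma max_non_overlapping_ge (l m n : nat) :
  (m * l ^ n <= max_non_overlapping n.+1 (l + m))%N.
Proof.
have -> : (m * l ^ n)%N = #|[set head_tail_word p | p : 'I_m * n.-tuple 'I_l]|.
  rewrite card_imset; last exact: head_tail_word_inj.
  by rewrite card_prod card_tuple !card_ord.
apply: leq_bigmax_cond; apply/asboolP => _ _ /imsetP[p _ ->] /imsetP[r _ ->].
by case; exact: head_tail_words_prefix_meets_suffix.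
Qed.

Lemma le_limn_einf (R : realType) (u v : nat -> \bar R) :
  (forall k, (u k <= v k)%E) -> (limn_einf u <= limn_einf v)%E.
Proof.
move=> uv; rewrite !limn_einf_lim.
apply: lee_lim; [exact: is_cvg_einfs|exact: is_cvg_einfs|].
apply: nearW => k; apply: le_ereal_inf_tmp => _ [j /= kj <-].
by apply: ereal_inf_le; exists (u j) => //; exists j.
Qed.

(** Rounding down loses less than 1, so the ratio is squeezed between [a/n - 1/q] and [a/n]. *)
Lemma divn_ratio_cvg (R : realType) (a n : nat) : (0 < n)%N ->
  ((((a * q) %/ n)%N%:R / q%:R : R) @[q --> \oo] --> (a%:R / n%:R : R))%classic.
Proof.
move=> n0; have nR0 : 0 < n%:R :> R by rewrite ltr0n.
(* The shift avoids [q = 0] and turns the error [1/q] into [harmonic]. *)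
rewrite -cvg_shiftS.
apply: (@squeeze_cvgr _ _ _ _ (fun q => a%:R / n%:R - harmonic q) (cst (a%:R / n%:R))).
- apply: nearW => q; have q0 : 0 < q.+1%:R :> R by rewrite ltr0n.
  apply/andP; split.
    rewrite lerBlDr /harmonic /= -[X in _ + X]mul1r -mulrDl ler_pdivlMr // mulrAC.
    rewrite ler_pdivrMr // natr1 -!natrM ler_nat.
    by rewrite ltnW // ltn_ceil.
  rewrite /= ler_pdivrMr // mulrAC ler_pdivlMr // -!natrM ler_nat.
  exact: leq_divM.
- have := cvgB (cvg_cst (a%:R / n%:R : R)) (@cvg_harmonic R).
  by rewrite subr0; apply.
- exact: cvg_cst.
Qed.

Lemma max_non_overlapping_ratio_ge (R : realType) (m q : nat) : (0 < m)%N ->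
  (((m * q) %/ m.+1)%N%:R / q%:R : R) ^+ m <=
  (max_non_overlapping m.+1 q)%:R / (q%:R ^+ m.+1 / m.+1%:R).
Proof.
(* At [q = 0] both sides are 0, since division by 0 gives 0 and [0 < m]. *)
move=> m0; have [->|q0] := posnP q.
  by rewrite muln0 div0n mul0r !expr0n eqn0Ngt m0 mul0r invr0 mulr0.
set l := (_ %/ _)%N.
have ln : (l * m.+1 <= m * q)%N by exact: leq_divM.
have lq : (l <= q)%N.
  by rewrite -(leq_pmul2r (ltn0Sn m)) (leq_trans ln)// mulnC leq_mul.
(* Rounding [l] down leaves at least [q / m.+1] head letters. *)
have qn : (q <= (q - l) * m.+1)%N.
  by rewrite mulnBl [(q * _)%N]mulnS [(q * m)%N]mulnC -addnBA// leq_addr.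
have := max_non_overlapping_ge l (q - l) m; rewrite subnKC // => H.
(* Clearing denominators leaves [l ^ m * q] on the left, which [qn] bounds by [m.+1] times the code
   size. *)
rewrite invf_div mulrA ler_pdivlMr ?exprn_gt0 ?ltr0n//.
rewrite exprSr mulrA -exprMn divfK ?pnatr_eq0 -?lt0n//.
rewrite -natrX -!natrM ler_nat; apply: (leq_trans _ (leq_mul H (leqnn _))).
by rewrite mulnAC mulnC leq_mul.
Qed.

Theorem theorem5 (R : realType) (n : nat) (hn : (2 <= n)%N) :
  ((((n%:R - 1) / n%:R : R) ^+ (n - 1)%N)%:E <=
   limn_einf (fun q : nat =>
     ((max_non_overlapping n q)%:R / (q%:R ^+ n / n%:R) : R)%:E))%E.
Proof.
case: n hn => [//|m]; rewrite ltnS => m0.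
rewrite subn1 /= -[X in (X - 1)]natr1 addrK.
pose v q : R := ((m * q) %/ m.+1)%N%:R / q%:R.
have vE : (v q ^+ m @[q --> \oo] --> ((m%:R / m.+1%:R : R) ^+ m))%classic.
  apply: (@continuous_cvg _ _ _ _ _ v (fun x : R => x ^+ m)).
    exact: exprn_continuous.
  exact: divn_ratio_cvg.
have uE : ((v q ^+ m)%:E @[q --> \oo] --> ((m%:R / m.+1%:R) ^+ m)%:E)%classic.
  by apply: cvg_EFin vE; exact: nearW.
(* The bound converges, so its limit is its liminf, and termwise comparison suffices. *)
rewrite -(cvg_limn_einf_sup uE).1; apply: le_limn_einf => q.
by rewrite lee_fin; exact: max_non_overlapping_ratio_ge.
Qed.
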